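(* Let $\mathcal{S}$ and $\mathcal{A}$ be finite sets of states and actions. Let $H>0$ be a positive integer and $\epsilon\in(0,1/2)$ be an error parameter. Let $\mathcal{K}$ be an algorithm that, on input an $H$-MDP $\mathcal{M}=(\mathcal{S},\mathcal{A},P,\boldsymbol{r})$ with a sampling oracle, outputs a policy $\pi:\mathcal{S}\times[H]\to\mathcal{A}$ such that $\|\boldsymbol{v}^\pi_h-\boldsymbol{v}^*_h\|_\infty\le\epsilon$ for all $h\in[H]$, with probability at least $0.9$. Then $\mathcal{K}$ calls the sampling oracle at least $$\Omega\left(\frac{H^{3}\epsilon^{-2}|\mathcal{S}||\mathcal{A}|}{\log\epsilon^{-1}}\right)$$ times on the worst-case input $P$ and $\boldsymbol{r}\in[0,1]^{\mathcal{S}}$.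
   Context: An $H$-MDP (finite-horizon MDP with horizon $H$) has a finite state space $\mathcal{S}$, finite action space $\mathcal{A}$, stage-independent transition probability vectors $P(\cdot\mid s,a)=\boldsymbol{P}_{s,a}$ over $\mathcal{S}$, and known rewards in $[0,1]$ (a reward $\boldsymbol{r}\in[0,1]^{\mathcal{S}}$ depends only on the state, i.e. $\boldsymbol{r}(s,a)=\boldsymbol{r}(s)$); $[H]=\{1,\dots,H\}$. The algorithm accesses $P$ only through a sampling oracle which, given $(s,a)$, returns an independent sample of a state from $P(\cdot\mid s,a)$. For a policy $\pi:\mathcal{S}\times[H]\to\mathcal{A}$, $\boldsymbol{v}^\pi_{H+1}=\boldsymbol{0}$ and $\boldsymbol{v}^\pi_h(s)=\boldsymbol{r}(s,\pi(s,h))+\boldsymbol{P}_{s,\pi(s,h)}^\top\boldsymbol{v}^\pi_{h+1}$. The optimal stage values are $\boldsymbol{v}^*_{H+1}=\boldsymbol{0}$ and $\boldsymbol{v}^*_h(s)=\max_{a\in\mathcal{A}}[\boldsymbol{r}(s,a)+\boldsymbol{P}_{s,a}^\top\boldsymbol{v}^*_{h+1}]$ for $h=H,\dots,1$. $\Omega(\cdot)$ is the usual asymptotic lower-bound notation, hiding an absolute constant.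
   Formalization: The formal theorem assumes |S| ≥ 2, |A| ≥ 2 and H ≥ 2; if H = 1, |A| = 1 or |S| = 1, all policies have the same value (rewards depend only on the state), so zero calls suffice and the bound fails. Calls are counted in expectation. *)

(* Defs.v *)
From HB Require Import structures.
From mathcomp Require Import all_boot all_order all_algebra.
From mathcomp Require Import all_classical all_reals all_analysis.

Set Implicit Arguments.
Unset Strict Implicit.
Unset Printing Implicit Defensive.

Import Order.TTheory GRing.Theory Num.Theory.

Local Open Scope ring_scope.

Record fdist (R : realType) (T : finType) := FDist {
  fdist_fun :> T -> R;
  fdist_ge0 : forall x, 0 <= fdist_fun x;
  fdist_sum1 : \sum_x fdist_fun x = 1 }.

Record mdp (R : realType) (S A : finType) := MDP {
  trans : S -> A -> fdist R S;
  reward : S -> R;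
  reward01 : forall s, 0 <= reward s <= 1 }.

(* Stages are numbered from 0: [i : 'I_H] stands for stage i+1 of {1, ..., H}. *)
Definition policy (S A : finType) (H : nat) : finType := {ffun S * 'I_H -> A}.

Definition bellman (R : realType) (S A : finType) (M : mdp R S A)
    (a : A) (v : S -> R) (s : S) : R :=
  reward M s + \sum_(s' : S) trans M s a s' * v s'.

(* Backward induction over the list h, h+1, ..., H-1 of remaining stages; see
   [value_end] and [value_step] for the recursion it satisfies. *)
Definition value (R : realType) (S A : finType) (H : nat) (M : mdp R S A)
    (pi : policy S A H) (h : nat) : S -> R :=
  foldr (fun (i : 'I_H) v s => bellman M (pi (s, i)) v s)
    (fun=> 0) (drop h (enum 'I_H)).

(* The default value 0 of the maximum is harmless: rewards are nonnegative. *)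
Definition opt_value (R : realType) (S A : finType) (H : nat) (M : mdp R S A)
    (h : nat) : S -> R :=
  foldr (fun (_ : 'I_H) v s => \big[Num.max/0]_(a : A) bellman M a v s)
    (fun=> 0) (drop h (enum 'I_H)).

Lemma drop_enum_ord (H : nat) (h : 'I_H) :
  drop h (enum 'I_H) = h :: drop h.+1 (enum 'I_H).
Proof. by rewrite (drop_nth h) ?size_enum_ord// nth_ord_enum. Qed.

Lemma value_end (R : realType) (S A : finType) (H : nat) (M : mdp R S A)
    (pi : policy S A H) (s : S) : value M pi H s = 0.
Proof. by rewrite /value drop_oversize// size_enum_ord. Qed.

Lemma value_step (R : realType) (S A : finType) (H : nat) (M : mdp R S A)
    (pi : policy S A H) (h : 'I_H) (s : S) :
  value M pi h s = bellman M (pi (s, h)) (value M pi h.+1) s.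
Proof. by rewrite /value drop_enum_ord. Qed.

Lemma opt_value_end (R : realType) (S A : finType) (H : nat) (M : mdp R S A)
    (s : S) : opt_value H M H s = 0.
Proof. by rewrite /opt_value drop_oversize// size_enum_ord. Qed.

Lemma opt_value_step (R : realType) (S A : finType) (H : nat) (M : mdp R S A)
    (h : 'I_H) (s : S) :
  opt_value H M h s =
  \big[Num.max/0]_(a : A) bellman M a (opt_value H M h.+1) s.
Proof. by rewrite /opt_value drop_enum_ord. Qed.

Definition supnorm (R : realType) (S : finType) (f : S -> R) : R :=
  \big[Num.max/0]_(s : S) `|f s|.

Definition eps_optimal (R : realType) (S A : finType) (H : nat)
    (M : mdp R S A) (eps : R) (pi : policy S A H) : bool :=
  [forall h : 'I_H,
    supnorm (fun s => value M pi h s - opt_value H M h s) <= eps].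

(* One entry (s, a, s') per oracle call, in chronological order: the query
   (s, a) and the sampled state s'. *)
Definition history (S A : finType) := seq (S * A * S).

(* A randomized adaptive algorithm. It knows the reward vector; after each
   history it draws, with its internal randomness, either the next oracle query
   [inl (s, a)] or the decision [inr pi] to stop and output [pi]. It sees the
   transition probabilities only through the history. *)
Definition algorithm (R : realType) (S A : finType) (H : nat) :=
  (S -> R) -> history S A -> fdist R (S * A + policy S A H)%type.

(* Probability, given that the calls so far are [past], that the next calls and
   their answers are exactly [next]; the answer to a query (s, a) is a fresh
   sample from [trans M s a]. *)
Fixpoint run_prob_from (R : realType) (S A : finType) (H : nat)
    (K : algorithm R S A H) (M : mdp R S A) (past next : history S A) : R :=
  if next is (s, a, s') :: next' then
    K (reward M) past (inl (s, a)) * trans M s a s' *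
      run_prob_from K M (rcons past (s, a, s')) next'
  else 1.

Definition run_prob (R : realType) (S A : finType) (H : nat)
    (K : algorithm R S A H) (M : mdp R S A) (w : history S A) : R :=
  run_prob_from K M [::] w.

(* Probability of stopping after exactly [n] calls with output [pi]. *)
Definition output_prob (R : realType) (S A : finType) (H : nat)
    (K : algorithm R S A H) (M : mdp R S A) (n : nat) (pi : policy S A H) : R :=
  \sum_(w : n.-tuple (S * A * S)) run_prob K M w * K (reward M) w (inr pi).

(* Runs that never stop count as failures. *)
Definition success_prob (R : realType) (S A : finType) (H : nat)
    (K : algorithm R S A H) (M : mdp R S A) (eps : R) : \bar R :=
  (\sum_(0 <= n <oo)
     (\sum_(pi : policy S A H | eps_optimal M eps pi)
        output_prob K M n pi)%:E)%E.

(* Probability that at least [n] calls are made. *)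
Definition calls_ge_prob (R : realType) (S A : finType) (H : nat)
    (K : algorithm R S A H) (M : mdp R S A) (n : nat) : R :=
  \sum_(w : n.-tuple (S * A * S)) run_prob K M w.

(* The number of calls is the sum over n of the indicators that an (n+1)-st
   call is made; it is infinite on the runs that never stop. *)
Definition expected_calls (R : realType) (S A : finType) (H : nat)
    (K : algorithm R S A H) (M : mdp R S A) : \bar R :=
  (\sum_(0 <= n <oo) (calls_ge_prob K M n.+1)%:E)%E.

(* Main.v *)
Require Import Defs.
From mathcomp Require Import all_boot all_order all_algebra.
From mathcomp Require Import all_classical all_reals all_analysis.
From mathcomp Require Import ring lra zify.

(* Every state except one absorbing state [z] has reward 1; an action either
   stays put or falls into [z].  In the null instance every action stays with
   probability [p]; in the alternative indexed by (s, a) the action [a] at [s]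
   stays with probability [q > p].  An eps-optimal policy of the alternative
   must use [a] at [s] in most stages, which for fixed [s] can hold for only one
   action, so under the null instance it fails for most pairs.  A change of
   measure then forces about 1 / KL(p, q) calls at each such pair under the
   null instance.  For long horizons p = 1 - 1/(2H) and q - p of order eps/H^2
   give KL of order eps^2/H^3; for H < 64 the last but one stage alone gives
   KL of order eps^2, which suffices. *)

Set Implicit Arguments.
Unset Strict Implicit.
Unset Printing Implicit Defensive.

Import Order.TTheory GRing.Theory Num.Theory.

Local Open Scope ring_scope.

(** * Expectations of truncated runs and change of measure *)

Lemma sum_tuple_rcons (R : nmodType) (T : finType) (n : nat) (F : seq T -> R) :
  \sum_(w : n.+1.-tuple T) F w =
  \sum_(w : n.-tuple T) \sum_(x : T) F (rcons w x).
Proof.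
rewrite pair_big /=.
pose f (u : n.-tuple T * T) : n.+1.-tuple T := [tuple of rcons u.1 u.2].
have f_inj : injective f.
  move=> [u x] [v y] /(congr1 val) /= /rcons_inj [uv ->].
  by congr (_, _); apply: val_inj.
have [|g fK gK] := inj_card_bij f_inj.
  by rewrite card_prod !card_tuple expnSr.
by rewrite (reindex f) //; exists g => ? _; [exact: fK | exact: gK].
Qed.

Lemma sum_query (R : nmodType) (S A : finType) (F : S * A * S -> R) :
  \sum_x F x = \sum_(s : S) \sum_(a : A) \sum_(s' : S) F (s, a, s').
Proof.
rewrite (pair_bigA _ (fun s a => \sum_s' F (s, a, s'))) /=.
rewrite (pair_bigA _ (fun sa s' => F (sa.1, sa.2, s'))) /=.
by apply: eq_bigr => -[[s a] s'] _.
Qed.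

Lemma run_prob_from_rcons (R : realType) (S A : finType) (H : nat)
    (K : algorithm R S A H) (M : mdp R S A) (past w : history S A) x :
  run_prob_from K M past (rcons w x) =
  run_prob_from K M past w *
    (K (reward M) (past ++ w) (inl x.1) * trans M x.1.1 x.1.2 x.2).
Proof.
elim: w past => [|[[t b] t'] w IH] past /=.
  by case: x => -[s a] s'; rewrite cats0 mulr1 mul1r.
by rewrite IH cat_rcons !mulrA.
Qed.

Lemma run_prob_rcons (R : realType) (S A : finType) (H : nat)
    (K : algorithm R S A H) (M : mdp R S A) (w : history S A) x :
  run_prob K M (rcons w x) =
  run_prob K M w * (K (reward M) w (inl x.1) * trans M x.1.1 x.1.2 x.2).
Proof. exact: run_prob_from_rcons. Qed.

Lemma run_prob_ge0 (R : realType) (S A : finType) (H : nat)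
    (K : algorithm R S A H) (M : mdp R S A) (w : history S A) :
  0 <= run_prob K M w.
Proof.
elim/last_ind: w => [|w x IH]; first exact: ler01.
by rewrite run_prob_rcons !mulr_ge0 ?fdist_ge0.
Qed.

(* Expectation of the payoff [f] of the run cut off after [n] calls:
   [f w (Some pi)] if it outputs [pi] after the calls [w] with [size w < n],
   and [f w None] if it makes the [n] calls [w]. *)
Definition trunc_exp (R : realType) (S A : finType) (H : nat)
    (K : algorithm R S A H) (M : mdp R S A) (n : nat)
    (f : history S A -> option (policy S A H) -> R) : R :=
  \sum_(k < n) \sum_(w : k.-tuple (S * A * S)) \sum_(pi : policy S A H)
     run_prob K M w * K (reward M) w (inr pi) * f w (Some pi)
  + \sum_(w : n.-tuple (S * A * S)) run_prob K M w * f w None.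

Lemma le_trunc_exp (R : realType) (S A : finType) (H : nat)
    (K : algorithm R S A H) (M : mdp R S A) (n : nat)
    (f g : history S A -> option (policy S A H) -> R) :
  (forall w o, f w o <= g w o) -> trunc_exp K M n f <= trunc_exp K M n g.
Proof.
move=> fg; apply: lerD.
  apply: ler_sum => k _; apply: ler_sum => w _; apply: ler_sum => pi _.
  by rewrite ler_wpM2l // mulr_ge0 ?run_prob_ge0 ?fdist_ge0.
by apply: ler_sum => w _; rewrite ler_wpM2l ?run_prob_ge0.
Qed.

Lemma trunc_expD (R : realType) (S A : finType) (H : nat)
    (K : algorithm R S A H) (M : mdp R S A) (n : nat)
    (f g : history S A -> option (policy S A H) -> R) :
  trunc_exp K M n (fun w o => f w o + g w o) =
  trunc_exp K M n f + trunc_exp K M n g.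
Proof.
rewrite /trunc_exp addrACA -!big_split /=; congr (_ + _).
  apply: eq_bigr => k _; rewrite -big_split; apply: eq_bigr => w _.
  by rewrite -big_split; apply: eq_bigr => pi _; rewrite mulrDr.
by apply: eq_bigr => w _; rewrite mulrDr.
Qed.

Lemma trunc_expZ (R : realType) (S A : finType) (H : nat)
    (K : algorithm R S A H) (M : mdp R S A) (n : nat) (c : R)
    (f : history S A -> option (policy S A H) -> R) :
  trunc_exp K M n (fun w o => c * f w o) = c * trunc_exp K M n f.
Proof.
rewrite /trunc_exp mulrDr !mulr_sumr; congr (_ + _).
  apply: eq_bigr => k _; rewrite mulr_sumr; apply: eq_bigr => w _.
  by rewrite mulr_sumr; apply: eq_bigr => pi _; rewrite mulrCA.
by apply: eq_bigr => w _; rewrite mulrCA.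
Qed.

Lemma eq_trunc_exp (R : realType) (S A : finType) (H : nat)
    (K : algorithm R S A H) (M : mdp R S A) (n : nat)
    (f g : history S A -> option (policy S A H) -> R) :
  (forall w o, f w o = g w o) -> trunc_exp K M n f = trunc_exp K M n g.
Proof. by move=> fg; congr trunc_exp; apply/funext => w; apply/funext. Qed.

Lemma trunc_exp_sum (R : realType) (S A : finType) (H : nat)
    (K : algorithm R S A H) (M : mdp R S A) (n : nat) (I : finType)
    (P : pred I) (f : I -> history S A -> option (policy S A H) -> R) :
  trunc_exp K M n (fun w o => \sum_(i | P i) f i w o) =
  \sum_(i | P i) trunc_exp K M n (f i).
Proof.
under eq_trunc_exp => w o do rewrite -big_filter.
rewrite -[RHS]big_filter.
elim: [seq i <- _ | _] => [|i r IH].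
  rewrite big_nil -[RHS](mul0r (trunc_exp K M n (fun _ _ => 0))) -trunc_expZ.
  by apply: eq_trunc_exp => w o; rewrite big_nil mul0r.
rewrite big_cons -IH -trunc_expD; apply: eq_trunc_exp => w o.
by rewrite big_cons.
Qed.

(** Raising the cut turns a run that has made [n] calls either into a stopped run with the same
    payoff or into a longer one, so only the mean increment of [G] over one call is added. *)
Lemma trunc_expS (R : realType) (S A : finType) (H : nat)
    (K : algorithm R S A H) (M : mdp R S A) (n : nat) (G : history S A -> R) :
  trunc_exp K M n.+1 (fun w _ => G w) =
  trunc_exp K M n (fun w _ => G w) +
  \sum_(w : n.-tuple (S * A * S)) run_prob K M w *
    \sum_s \sum_a K (reward M) w (inl (s, a)) *
      \sum_s' trans M s a s' * (G (rcons w (s, a, s')) - G w).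
Proof.
rewrite /trunc_exp big_ord_recr /= -!addrA; congr (_ + _).
rewrite (sum_tuple_rcons n (fun w => run_prob K M w * G w)) -!big_split /=.
apply: eq_bigr => w _.
have sumK : \sum_pi K (reward M) w (inr pi) =
    1 - \sum_s \sum_a K (reward M) w (inl (s, a)).
  apply/eqP; rewrite eq_sym subr_eq -(fdist_sum1 (K (reward M) w)).
  rewrite big_sumType addrC; apply/eqP; congr (_ + _).
  by rewrite pair_bigA; apply: eq_bigr => -[].
rewrite -mulr_suml -mulr_sumr sumK.
have -> : \sum_x run_prob K M (rcons w x) * G (rcons w x) = run_prob K M w *
    (\sum_s \sum_a K (reward M) w (inl (s, a)) *
       (\sum_s' trans M s a s' * (G (rcons w (s, a, s')) - G w)) +
     (\sum_s \sum_a K (reward M) w (inl (s, a))) * G w); last by ring.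
rewrite sum_query mulr_suml -big_split mulr_sumr; apply: eq_bigr => s _ /=.
rewrite mulr_suml -big_split mulr_sumr; apply: eq_bigr => a _ /=.
rewrite -mulrDr -[in X in _ + X](mulr1 (G w)) -(fdist_sum1 (trans M s a)).
rewrite mulr_sumr -big_split !mulr_sumr; apply: eq_bigr => s' _ /=.
by rewrite run_prob_rcons /=; ring.
Qed.

Lemma trunc_exp0 (R : realType) (S A : finType) (H : nat)
    (K : algorithm R S A H) (M : mdp R S A)
    (f : history S A -> option (policy S A H) -> R) :
  trunc_exp K M 0 f = f [::] None.
Proof.
rewrite /trunc_exp big_ord0 add0r (big_pred1 [tuple]); last first.
  by move=> w; apply/esym/eqP; exact: tuple0.
by rewrite mul1r.
Qed.

(** Optional stopping at a bounded time: by [trunc_expS] each further call adds a nonnegative mean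
    increment. *)
Lemma submartingale_trunc_exp (R : realType) (S A : finType) (H : nat)
    (K : algorithm R S A H) (M : mdp R S A) (n : nat) (G : history S A -> R) :
  (forall w s a,
     0 <= \sum_s' trans M s a s' * (G (rcons w (s, a, s')) - G w)) ->
  G [::] <= trunc_exp K M n (fun w _ => G w).
Proof.
move=> subG; elim: n => [|n /le_trans]; first by rewrite trunc_exp0.
apply; rewrite trunc_expS lerDl sumr_ge0 // => w _.
rewrite mulr_ge0 ?run_prob_ge0 // sumr_ge0 // => s _.
by rewrite sumr_ge0 // => a _; rewrite mulr_ge0 ?fdist_ge0.
Qed.

Lemma trunc_exp1 (R : realType) (S A : finType) (H : nat)
    (K : algorithm R S A H) (M : mdp R S A) (n : nat) :
  trunc_exp K M n (fun _ _ => 1) = 1.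
Proof.
elim: n => [|n IH]; first by rewrite trunc_exp0.
rewrite (trunc_expS K M n (fun=> 1)) IH big1 ?addr0 // => w _.
rewrite big1 ?mulr0 // => s _; rewrite big1 // => a _.
by rewrite big1 ?mulr0 // => s' _; rewrite subrr mulr0.
Qed.

(** Each call raises [size] by one. This identifies the partial sums of [expected_calls] with
    truncated expectations. *)
Lemma trunc_exp_size (R : realType) (S A : finType) (H : nat)
    (K : algorithm R S A H) (M : mdp R S A) (n : nat) :
  trunc_exp K M n (fun w _ => (size w)%:R) =
  \sum_(k < n) calls_ge_prob K M k.+1.
Proof.
elim: n => [|n IH]; first by rewrite trunc_exp0 big_ord0.
rewrite (trunc_expS K M n (fun w => (size w)%:R)) IH big_ord_recr /=.
congr (_ + _); rewrite /calls_ge_prob (sum_tuple_rcons n (run_prob K M)).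
apply: eq_bigr => w _.
rewrite sum_query mulr_sumr; apply: eq_bigr => s _.
rewrite mulr_sumr; apply: eq_bigr => a _; rewrite !mulr_sumr.
apply: eq_bigr => s' _.
by rewrite run_prob_rcons size_rcons -natr1 addrAC subrr add0r mulr1.
Qed.

(** The draws of the algorithm depend on the instance only through the rewards, which agree; they
    cancel in the likelihood ratio, and only the oracle answers contribute to it. *)
Lemma change_of_measure (R : realType) (S A : finType) (H : nat)
    (K : algorithm R S A H) (M0 M1 : mdp R S A) (r : S * A * S -> R) (n : nat)
    (f : history S A -> option (policy S A H) -> R) :
  reward M1 = reward M0 ->
  (forall s a s', trans M1 s a s' = trans M0 s a s' * r (s, a, s')) ->
  trunc_exp K M1 n f = trunc_exp K M0 n (fun w o => \prod_(x <- w) r x * f w o).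
Proof.
move=> eqr eqt.
have run1 w : run_prob K M1 w = run_prob K M0 w * \prod_(x <- w) r x.
  elim/last_ind: w => [|w [[s a] s'] IH]; first by rewrite big_nil mulr1.
  by rewrite !run_prob_rcons big_rcons IH eqt eqr /=; ring.
rewrite /trunc_exp eqr; congr (_ + _).
  apply: eq_bigr => k _; apply: eq_bigr => w _; apply: eq_bigr => pi _.
  by rewrite run1; ring.
by apply: eq_bigr => w _; rewrite run1; ring.
Qed.

(** * Logarithm bounds and transport of events between instances *)

Lemma ln_le_subr1 (R : realType) (x : R) : 0 < x -> ln x <= x - 1.
Proof.
by move=> x0; rewrite -{1}(subrKC 1 x) le_ln1Dx // ltrBrDl subrr.
Qed.

Lemma ln_ge_1subV (R : realType) (x : R) : 0 < x -> 1 - x^-1 <= ln x.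
Proof.
move=> x0; have := ln_le_subr1 (x := x^-1); rewrite invr_gt0 lnV ?posrE //.
by move=> /(_ x0); lra.
Qed.

Lemma ln2_ge_half (R : realType) : 1 / 2 <= ln (2 : R).
Proof. by have := @ln_ge_1subV R 2 (ltr0Sn _ _); lra. Qed.

Lemma ln_prod (R : realType) (T : Type) (r : T -> R) (w : seq T) :
  (forall x, 0 < r x) -> ln (\prod_(x <- w) r x) = \sum_(x <- w) ln (r x).
Proof.
move=> r0; elim: w => [|x w IH]; first by rewrite !big_nil ln1.
by rewrite !big_cons lnM ?posrE ?prodr_gt0 // IH.
Qed.

(* If [d] dominates the one-call divergence of [M0] from [M1], then
   sum (ln r + d) - (prod r - 1) is a submartingale under [M0].  With
   rho = prod r, bound its final value by ln rho <= rho - 1 off [B] and by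
   ln rho <= 2 rho - 1 - ln 2 <= 2 rho - 3/2 on [B]. *)
Lemma transport_event (R : realType) (S A : finType) (H : nat)
    (K : algorithm R S A H) (M0 M1 : mdp R S A) (r : S * A * S -> R)
    (d : S * A * S -> R) (n : nat)
    (B : option (policy S A H) -> bool) :
  reward M1 = reward M0 ->
  (forall s a s', trans M1 s a s' = trans M0 s a s' * r (s, a, s')) ->
  (forall x, 0 < r x) ->
  (forall s a,
     0 <= \sum_s' trans M0 s a s' * (ln (r (s, a, s')) + d (s, a, s'))) ->
  1 / 2 * trunc_exp K M0 n (fun _ o => (B o)%:R) <=
  trunc_exp K M0 n (fun w _ => \sum_(x <- w) d x) +
  trunc_exp K M1 n (fun _ o => (B o)%:R).
Proof.
move=> eqr eqt r0 dP.
pose G (w : history S A) : R :=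
  \sum_(x <- w) (ln (r x) + d x) - (\prod_(x <- w) r x - 1).
have G_ge0 := @submartingale_trunc_exp _ _ _ _ K M0 n G.
have G0 : G [::] = 0 by rewrite /G !big_nil !subrr.
rewrite G0 in G_ge0.
rewrite (change_of_measure _ _ _ eqr eqt) -trunc_expZ -subr_ge0 -addrA -mulN1r.
rewrite -trunc_expZ -!trunc_expD.
apply: le_trans (G_ge0 _) _ => [w s a|].
  (* The likelihood ratio is a martingale under [M0]: its mean increment is a multiple of the
     difference of two total masses, both 1. Only the part bounded by [dP] remains. *)
  under eq_bigr => s' _.
    rewrite (_ : _ * _ = trans M0 s a s' * (ln (r (s, a, s')) + d (s, a, s'))
      - \prod_(x <- w) r x * (trans M1 s a s' - trans M0 s a s')); last first.
      rewrite /G !big_rcons /= eqt; ring.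
    over.
  rewrite sumrB -mulr_sumr sumrB !fdist_sum1 subrr mulr0 subr0; exact: dP.
apply: le_trunc_exp => w o; rewrite /G big_split /= -ln_prod //.
set rho := \prod_(x <- w) r x.
have rho0 : 0 < rho by rewrite prodr_gt0.
case: (B o); rewrite ?mulr1 ?mulr0.
  have := ln_le_subr1 (mulr_gt0 (ltr0Sn R 1) rho0).
  rewrite lnM ?posrE //; have := ln2_ge_half R; lra.
by have := ln_le_subr1 rho0; lra.
Qed.

(** * Chains with one absorbing state *)

Lemma sum_stay (R : realType) (S : finType) (z s : S) (x : R) (v : S -> R) :
  \sum_s' (x * (s' == s)%:R + (1 - x) * (s' == z)%:R) * v s' =
  x * v s + (1 - x) * v z.
Proof.
have sum_delta t : \sum_s' (s' == t)%:R * v s' = v t.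
  rewrite (bigD1 t) //= eqxx mul1r big1 ?addr0 // => s' /negbTE ->.
  by rewrite mul0r.
rewrite -(sum_delta s) -(sum_delta z) !mulr_sumr -big_split /=.
by apply: eq_bigr => s' _; ring.
Qed.

Lemma stay_ge0 (R : realType) (S : finType) (z s : S) (x : R) :
  0 <= x <= 1 -> forall s', 0 <= x * (s' == s)%:R + (1 - x) * (s' == z)%:R.
Proof.
by move=> /andP[x0 x1] s'; rewrite addr_ge0 // mulr_ge0 ?ler0n ?subr_ge0.
Qed.

Lemma stay_sum1 (R : realType) (S : finType) (z s : S) (x : R) :
  \sum_s' (x * (s' == s)%:R + (1 - x) * (s' == z)%:R) = 1.
Proof.
under eq_bigr => s' _ do rewrite -[_ + _]mulr1.
by rewrite (sum_stay z s x (fun=> 1)); ring.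
Qed.

(** At [s = z] the two point masses coincide, so [z] is absorbing for every [x]. *)
Definition stay_fdist (R : realType) (S : finType) (z s : S) (x : R)
    (x01 : 0 <= x <= 1) : fdist R S :=
  FDist (stay_ge0 z s x01) (stay_sum1 z s x).

Lemma alive_reward01 (R : realType) (S : finType) (z s : S) :
  0 <= ((s != z)%:R : R) <= 1.
Proof. by rewrite ler0n lern1 leq_b1. Qed.

(* In state [s], action [a] stays in [s] with probability [f s a] and otherwise
   falls into the absorbing state [z], the only one without reward. *)
Definition chain_mdp (R : realType) (S A : finType) (z : S) (f : S -> A -> R)
    (f01 : forall s a, 0 <= f s a <= 1) : mdp R S A :=
  MDP (fun s a => stay_fdist z s (f01 s a)) (alive_reward01 R z).

Lemma bellman_chain (R : realType) (S A : finType) (z : S) (f : S -> A -> R)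
    (f01 : forall s a, 0 <= f s a <= 1) (a : A) (v : S -> R) (s : S) :
  bellman (chain_mdp z f01) a v s =
  (s != z)%:R + (f s a * v s + (1 - f s a) * v z).
Proof. by rewrite /bellman /= sum_stay. Qed.

Lemma value_chain_absorbing (R : realType) (S A : finType) (H : nat) (z : S)
    (f : S -> A -> R) (f01 : forall s a, 0 <= f s a <= 1) (pi : policy S A H)
    (h : nat) : value (chain_mdp z f01) pi h z = 0.
Proof.
rewrite /value; elim: (drop h _) => //= i l IH.
by rewrite bellman_chain eqxx IH !mulr0 !addr0.
Qed.

Lemma opt_value_ge0 (R : realType) (S A : finType) (H : nat) (M : mdp R S A)
    (h : nat) (s : S) : 0 <= opt_value H M h s.
Proof.
by rewrite /opt_value; case: (drop h _) => [|i l] //=; exact: bigmax_ge_id.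
Qed.

Lemma value_chain (R : realType) (S A : finType) (H : nat) (z : S)
    (f : S -> A -> R) (f01 : forall s a, 0 <= f s a <= 1) (pi : policy S A H)
    (h : 'I_H) (s : S) : s != z ->
  value (chain_mdp z f01) pi h s =
  1 + f s (pi (s, h)) * value (chain_mdp z f01) pi h.+1 s.
Proof.
move=> sz; rewrite value_step bellman_chain sz value_chain_absorbing.
by rewrite mulr0 addr0.
Qed.

Lemma opt_value_chain_ge (R : realType) (S A : finType) (H : nat) (z : S)
    (f : S -> A -> R) (f01 : forall s a, 0 <= f s a <= 1) (h : 'I_H) (s : S)
    (a : A) : s != z ->
  1 + f s a * opt_value H (chain_mdp z f01) h.+1 s <=
  opt_value H (chain_mdp z f01) h s.
Proof.
move=> sz; rewrite opt_value_step; apply: le_trans (le_bigmax _ _ a).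
rewrite bellman_chain sz lerD2l lerDl mulr_ge0 ?opt_value_ge0 // subr_ge0.
by case/andP: (f01 s a).
Qed.

Lemma eps_optimal_gap (R : realType) (S A : finType) (H : nat) (M : mdp R S A)
    (eps : R) (pi : policy S A H) (h : 'I_H) (s : S) :
  eps_optimal M eps pi -> opt_value H M h s - value M pi h s <= eps.
Proof.
move=> /forallP/(_ h); apply: le_trans; rewrite /supnorm.
apply: le_trans (le_bigmax _ _ s); rewrite distrC; exact: ler_norm.
Qed.

(** * Optimality gap in the one-arm alternatives *)

Definition one_arm (R : realType) (S A : finType) (p q : R) (s1 : S) (a1 : A)
    (s : S) (a : A) : R := if (s, a) == (s1, a1) then q else p.

Lemma one_arm01 (R : realType) (S A : finType) (p q : R) (s1 : S) (a1 : A) :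
  0 <= p <= 1 -> 0 <= q <= 1 ->
  forall (s : S) (a : A), 0 <= one_arm p q s1 a1 s a <= 1.
Proof. by move=> p01 q01 s a; rewrite /one_arm; case: ifP. Qed.

(** The optimum is at least the value of playing [a] now. If the policy also plays [a], the later
    gap is carried over with factor [q >= p]; otherwise it survives only with probability [p] and
    loses [q - p] times the optimal continuation. *)
Lemma gap_step (R : realType) (S A : finType) (H : nat) (z s : S) (a : A)
    (p q : R) (f01 : forall t b, 0 <= one_arm p q s a t b <= 1)
    (pi : policy S A H) (h : 'I_H) : s != z -> p <= q ->
  0 <= opt_value H (chain_mdp z f01) h.+1 s -
       value (chain_mdp z f01) pi h.+1 s ->
  p * (opt_value H (chain_mdp z f01) h.+1 s - value (chain_mdp z f01) pi h.+1 s)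
  + (pi (s, h) != a)%:R * (q - p) * opt_value H (chain_mdp z f01) h.+1 s <=
  opt_value H (chain_mdp z f01) h s - value (chain_mdp z f01) pi h s.
Proof.
move=> sz pq gap0; rewrite value_chain //.
have := @opt_value_chain_ge _ _ _ H _ _ f01 h s a sz.
rewrite /one_arm eqxx xpair_eqE eqxx /=.
case: eqP => /= _; nra.
Qed.

Lemma stage_ind (H : nat) (P : nat -> Prop) :
  P H -> (forall h : 'I_H, P h.+1 -> P h) -> forall h, (h <= H)%N -> P h.
Proof.
move=> PH Pstep h hH; rewrite -(subKn hH).
elim: (H - h)%N (leq_subr h H) => [|m IH] mH; first by rewrite subn0.
have lt_mH : (H - m.+1 < H)%N by rewrite ltn_subrL (leq_trans _ mH).
by apply: (Pstep (Ordinal lt_mH)); rewrite /= subnSK //; exact/IH/ltnW.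
Qed.

Lemma gap_ge0 (R : realType) (S A : finType) (H : nat) (z s : S) (a : A)
    (p q : R) (f01 : forall t b, 0 <= one_arm p q s a t b <= 1)
    (pi : policy S A H) : s != z -> 0 <= p <= q ->
  forall h, (h <= H)%N ->
  0 <= opt_value H (chain_mdp z f01) h s - value (chain_mdp z f01) pi h s.
Proof.
move=> sz /andP[p0 pq]; apply: stage_ind => [|h gap0].
  by rewrite value_end opt_value_end subrr.
apply: le_trans (gap_step sz pq gap0).
by rewrite addr_ge0 ?(mulr_ge0 p0 gap0) // !mulr_ge0 ?subr_ge0 ?opt_value_ge0.
Qed.

(** Playing [a] throughout survives all remaining stages with probability at least [p ^+ (H - h)],
    and then collects one unit of reward per stage. *)
Lemma opt_value_lower (R : realType) (S A : finType) (H : nat) (z s : S) (a : A)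
    (p q : R) (f01 : forall t b, 0 <= one_arm p q s a t b <= 1) :
  s != z -> 0 <= p <= q -> p <= 1 ->
  forall h, (h <= H)%N ->
  (H - h)%:R * p ^+ (H - h) <= opt_value H (chain_mdp z f01) h s.
Proof.
move=> sz /andP[p0 pq] p1; apply: stage_ind => [|h IH].
  by rewrite subnn mul0r opt_value_ge0.
apply: le_trans (opt_value_chain_ge f01 h a sz).
rewrite /one_arm eqxx -(subnSK (ltn_ord h)) exprS -natr1.
set m := (H - h.+1)%N in IH *.
have pm1 : p * p ^+ m <= 1 by rewrite -exprS exprn_ile1.
have pm0 : 0 <= p ^+ m by rewrite exprn_ge0.
have m0 : 0 <= m%:R :> R by rewrite ler0n.
set y := opt_value _ _ _ _ in IH *.
have : p * (m%:R * p ^+ m) <= q * y.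
  by rewrite ler_pM // mulr_ge0.
nra.
Qed.

(** [gap_step] unrolled: a wrong action at stage [i] loses [q - p] times a continuation of at least
    [(H - i.+1) * p ^+ (H - i.+1)], carried back to [h] with factor [p ^+ (i - h)]. The product of
    these powers is at least [p ^+ (H - h)]. *)
Lemma gap_lower (R : realType) (S A : finType) (H : nat) (z s : S) (a : A)
    (p q : R) (f01 : forall t b, 0 <= one_arm p q s a t b <= 1)
    (pi : policy S A H) : s != z -> 0 <= p <= q -> p <= 1 ->
  forall h, (h <= H)%N ->
  (q - p) * p ^+ (H - h) *
     (\sum_(i < H | (h <= i)%N && (pi (s, i) != a)) (H - i.+1))%:R <=
  opt_value H (chain_mdp z f01) h s - value (chain_mdp z f01) pi h s.
Proof.
move=> sz /[dup] pq' /andP[p0 pq] p1; apply: stage_ind => [|h IH].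
  by rewrite big1 ?mulr0 ?gap_ge0 // => i /andP[]; rewrite leqNgt ltn_ord.
apply: le_trans (gap_step sz pq (gap_ge0 f01 pi sz pq' (ltn_ord h))).
have -> : (\sum_(i < H | (h <= i)%N && (pi (s, i) != a)) (H - i.+1) =
  (pi (s, h) != a) * (H - h.+1) +
  \sum_(i < H | (h < i)%N && (pi (s, i) != a)) (H - i.+1))%N.
  rewrite big_mkcond (bigD1 h) //= leqnn /=; congr (_ + _)%N.
    by case: (pi _ != a); rewrite ?mul1n.
  rewrite [RHS]big_mkcond [RHS](bigD1 h) //= ltnn /= add0n.
  apply: eq_bigr => i ih.
  by rewrite [(h <= i)%N]leq_eqVlt eq_sym val_eqE (negbTE ih).
have y_ge := @opt_value_lower _ _ _ H _ _ _ _ _ f01 sz pq' p1 _ (ltn_ord h).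
have := ler_wpM2l p0 IH.
rewrite natrD natrM -(subnSK (ltn_ord h)) exprS.
set y := opt_value _ _ _ _ in y_ge *; set x := value _ _ _ _.
set W := (\sum_(i < H | _) _)%N => IHp.
rewrite mulrDr [leLHS]addrC lerD //.
  by move: IHp; rewrite !mulrA (mulrC p).
case: (pi _ != a); rewrite /= ?mul0r ?mulr0 // !mul1r -mulrA.
rewrite ler_wpM2l ?subr_ge0 //; apply: le_trans y_ge; rewrite mulrC.
by rewrite ler_wpM2l ?ler0n // ler_piMl ?exprn_ge0 //.
Qed.

(** * The lower bound *)

Lemma trunc_exp_output (R : realType) (S A : finType) (H : nat)
    (K : algorithm R S A H) (M : mdp R S A) (n : nat)
    (P : pred (policy S A H)) :
  trunc_exp K M n (fun _ o => if o is Some pi then (P pi)%:R else 0) =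
  \sum_(k < n) \sum_(pi | P pi) output_prob K M k pi.
Proof.
rewrite /trunc_exp [X in _ + X]big1 ?addr0 => [|w _]; last by rewrite mulr0.
apply: eq_bigr => k _; rewrite exchange_big [RHS]big_mkcond /=.
apply: eq_bigr => pi _; case: (P pi).
  by apply: eq_bigr => w _; rewrite mulr1.
by rewrite big1 // => w _; rewrite mulr0.
Qed.

Lemma output_prob_ge0 (R : realType) (S A : finType) (H : nat)
    (K : algorithm R S A H) (M : mdp R S A) (n : nat) (pi : policy S A H) :
  0 <= output_prob K M n pi.
Proof.
by apply: sumr_ge0 => w _; rewrite mulr_ge0 ?run_prob_ge0 ?fdist_ge0.
Qed.

(** A value strictly below the sum of a nonnegative series is reached by some partial sum and kept
    by all later ones. *)
Lemma success_prob_trunc (R : realType) (S A : finType) (H : nat)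
    (K : algorithm R S A H) (M : mdp R S A) (eps x : R) :
  (x%:E < success_prob K M eps)%E ->
  exists n0, forall n, (n0 <= n)%N -> x <=
    trunc_exp K M n
      (fun _ o => if o is Some pi then (eps_optimal M eps pi)%:R else 0).
Proof.
set u := fun k => \sum_(pi | eps_optimal M eps pi) output_prob K M k pi.
have u_ge0 k : 0 <= u k by apply: sumr_ge0 => pi _; exact: output_prob_ge0.
move=> lt_x; apply: contrapT => /forallNP no_n.
have : (success_prob K M eps <= x%:E)%E; last by rewrite leNgt lt_x.
apply: lime_le.
  by apply: is_cvg_nneseries => k _ _; rewrite lee_fin u_ge0.
apply: nearW => n; rewrite sumEFin lee_fin leNgt; apply/negP => ltx.
apply: (no_n n) => m nm; rewrite trunc_exp_output -(big_mkord xpredT u).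
apply: le_trans (ltW ltx) _; rewrite (big_cat_nat (leq0n n) nm) lerDl.
exact: sumr_ge0.
Qed.

Lemma sum_exclusive_le1 (R : realType) (I : finType) (P : pred I) :
  (forall i j, P i -> P j -> i = j) -> \sum_i (P i)%:R <= 1 :> R.
Proof.
move=> excl; have [i Pi|noP] := pickP P; last first.
  by rewrite big1 ?ler01 // => i _; rewrite noP.
rewrite (bigD1 i) //= big1 ?addr0 ?lern1 ?leq_b1 // => j ji.
by case Pj: (P j) => //; rewrite (excl _ _ Pi Pj) eqxx in ji.
Qed.

(** * Divergence of the chains and the calls it forces *)

Lemma bernoulli_kl_ge (R : realType) (p q : R) :
  0 < p < 1 -> 0 < q < 1 ->
  - ((q - p) ^+ 2 / (q * (1 - q))) <=
  p * ln (q / p) + (1 - p) * ln ((1 - q) / (1 - p)).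
Proof.
move=> /andP[p0 p1] /andP[q0 q1].
have q1' : 0 < 1 - q by lra.
have p1' : 0 < 1 - p by lra.
(* Applying [ln y >= 1 - 1 / y] to both terms bounds the Kullback-Leibler divergence by the
   chi-square divergence. *)
have l1 := ln_ge_1subV (divr_gt0 q0 p0).
have l2 := ln_ge_1subV (divr_gt0 q1' p1').
have := lerD (ler_wpM2l (ltW p0) l1) (ler_wpM2l (ltW p1') l2).
apply: le_trans; rewrite le_eqVlt; apply/orP; left; apply/eqP.
by field; rewrite !gt_eqF.
Qed.

Definition uniform_chain (R : realType) (S A : finType) (z : S) (p : R)
    (p01 : 0 <= p <= 1) : mdp R S A :=
  chain_mdp z (fun (_ : S) (_ : A) => p01).
Arguments uniform_chain {R} S A z {p} p01.

(** [s1 != z] keeps staying and falling apart. Answers other than [s1] and [z] have probability 0 in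
    both instances, so the ratio is free there; a positive value keeps its logarithm meaningful. *)
Lemma chain_trans_ratio (R : realType) (S A : finType) (z s1 : S) (a1 : A)
    (p q : R) (f0 : 0 <= p <= 1)
    (f1 : forall s a, 0 <= one_arm p q s1 a1 s a <= 1) (x : S * A * S) :
  s1 != z -> 0 < p < 1 ->
  trans (chain_mdp z f1) x.1.1 x.1.2 x.2 =
  trans (uniform_chain S A z f0) x.1.1 x.1.2 x.2 *
    (if x.1 == (s1, a1) then
       if x.2 == s1 then q / p else (1 - q) / (1 - p) else 1).
Proof.
move=> sz /andP[p0 p1]; have p1' : 0 < 1 - p by rewrite subr_gt0.
case: x => -[s a] s' /=; rewrite /one_arm.
case: (eqVneq (s, a) (s1, a1)) => [[-> _]|_]; last by rewrite mulr1.
have [->|s's1] := eqVneq s' s1.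
  by rewrite (negbTE sz) /=; field; rewrite gt_eqF.
rewrite /= !mulr0 !add0r; case: (s' == z); last by rewrite !mulr0 mul0r.
by rewrite /= !mulr1; field; rewrite gt_eqF.
Qed.

Lemma transport_chain (R : realType) (S A : finType) (H : nat)
    (K : algorithm R S A H) (z s1 : S) (a1 : A) (p q D : R)
    (f0 : 0 <= p <= 1)
    (f1 : forall s a, 0 <= one_arm p q s1 a1 s a <= 1) (n : nat)
    (B : option (policy S A H) -> bool) :
  s1 != z -> 0 < p < 1 -> 0 < q < 1 ->
  (q - p) ^+ 2 / (q * (1 - q)) <= D ->
  1 / 2 * trunc_exp K (uniform_chain S A z f0) n (fun _ o => (B o)%:R) <=
  D * trunc_exp K (uniform_chain S A z f0) n
        (fun w _ => (count (fun x => x.1 == (s1, a1)) w)%:R) +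
  trunc_exp K (chain_mdp z f1) n (fun _ o => (B o)%:R).
Proof.
move=> sz p01 q01 hD.
pose r (x : S * A * S) : R := if x.1 == (s1, a1) then
  if x.2 == s1 then q / p else (1 - q) / (1 - p) else 1.
(* A charge [D], which dominates the divergence, for each query at [(s1, a1)], and none elsewhere,
   where the instances agree. *)
pose d (x : S * A * S) : R := D * (x.1 == (s1, a1))%:R.
rewrite -trunc_expZ.
have -> : trunc_exp K (uniform_chain S A z f0) n
    (fun w _ => D * (count (fun x => x.1 == (s1, a1)) w)%:R) =
  trunc_exp K (uniform_chain S A z f0) n (fun w _ => \sum_(x <- w) d x).
  apply: eq_trunc_exp => w _; rewrite -mulr_sumr -natr_sum; congr (_ * _%:R).
  rewrite -sum1_count [RHS]big_mkcond /= big_mkcond.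
  by apply: eq_bigr => x _; case: eqP.
have [p0 p1] := andP p01; have [q0 q1] := andP q01.
apply: (@transport_event _ _ _ _ K _ (chain_mdp z f1) r) => //.
- by move=> s a s'; exact: (chain_trans_ratio f0 f1 (s, a, s') sz p01).
- by move=> x; rewrite /r; case: ifP => // _; case: ifP => _;
    rewrite divr_gt0 // subr_gt0.
move=> s a; rewrite sum_stay /r /d /=.
case: (eqVneq (s, a) (s1, a1)) => [[-> _]|_]; last first.
  by rewrite ln1 mulr0 addr0 !mulr0 addr0.
rewrite eqxx eq_sym (negbTE sz) mulr1.
by have := bernoulli_kl_ge p01 q01; lra.
Qed.

(** Each call is counted for at most one pair, so bounds for the separate pairs add up. *)
Lemma sum_count_query (S A : finType) (P : pred S) (w : history S A) :
  (\sum_(s | P s) \sum_a count (fun x => x.1 == (s, a)) w <= size w)%N.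
Proof.
elim: w => [|[[s a] s'] w IH] /=; first by rewrite big1 // => s _; rewrite big1.
under eq_bigr do rewrite big_split /=.
rewrite big_split -add1n leq_add //=.
rewrite big_mkcond (bigD1 s) //= [X in (_ + X)%N]big1 ?addn0 =>
    [|t ts]; last first.
  case: (P t) => //; rewrite big1 // => b _.
  by rewrite xpair_eqE eq_sym (negbTE ts).
case: (P s) => //.
rewrite (bigD1 a) //= big1 ?addn0 ?leq_b1 // => b ba.
by rewrite xpair_eqE [a == b]eq_sym (negbTE ba) andbF.
Qed.

(** [good s a] stands for what eps-optimality in the alternative (s, a) forces, so that both horizon
    regimes share the argument. Correctness is applied to the alternatives only; the calls are
    counted under the null instance. *)
Lemma chain_calls_lower (R : realType) (S A : finType) (H : nat)
    (K : algorithm R S A H) (eps : R) (z : S) (p q D : R)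
    (f0 : 0 <= p <= 1)
    (good : S -> A -> pred (policy S A H)) :
  (1 < #|S|)%N -> (1 < #|A|)%N ->
  (forall M, ((9 / 10)%:E <= success_prob K M eps)%E) ->
  0 < p < 1 -> 0 < q < 1 ->
  (q - p) ^+ 2 / (q * (1 - q)) <= D ->
  (forall s a b pi, good s a pi -> good s b pi -> a = b) ->
  (forall s a (f1 : forall t b, 0 <= one_arm p q s a t b <= 1) pi, s != z ->
     eps_optimal (chain_mdp z f1) eps pi -> good s a pi) ->
  exists n, #|S|%:R * #|A|%:R / 20 <=
    D * \sum_(k < n) calls_ge_prob K (uniform_chain S A z f0) k.+1.
Proof.
move=> hS hA hK p01 q01 hD excl opt_good.
have D0 : 0 <= D.
  apply: le_trans hD; case/andP: q01 => q0 q1.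
  by rewrite divr_ge0 ?sqr_ge0 // mulr_ge0 ?subr_ge0 ?(ltW q0) ?(ltW q1).
have wk (x : R) : 0 < x < 1 -> 0 <= x <= 1 by case/andP => x0 x1; rewrite !ltW.
have f1 s a := @one_arm01 R S A p q s a (wk _ p01) (wk _ q01).
(* Lowering 9/10 to 17/20 makes room for a finite cut; the maximum of these cuts then serves all
   alternatives. *)
have /choice[N hN] : forall u : S * A, exists n0, forall n, (n0 <= n)%N ->
    17 / 20 <= trunc_exp K (chain_mdp z (f1 u.1 u.2)) n (fun _ o =>
      if o is Some pi then
        (eps_optimal (chain_mdp z (f1 u.1 u.2)) eps pi)%:R else 0).
  move=> u; apply: success_prob_trunc; apply: lt_le_trans (hK _).
  by rewrite lte_fin; lra.
pose n := (\max_u N u)%N; exists n; rewrite -trunc_exp_size.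
set M0 := uniform_chain S A z f0.
pose E s a := trunc_exp K M0 n
  (fun w _ => (count (fun x => x.1 == (s, a)) w)%:R).
pose G s a := trunc_exp K M0 n
  (fun _ o => if o is Some pi then (good s a pi)%:R else 0).
have step s a : s != z -> 1 / 2 * (1 - G s a) <= D * E s a + 3 / 20.
  move=> sz.
  (* Runs that reach the cut count as bad, so [B] is the exact complement of [good]; under the
     alternative its probability is at most 3/20. *)
  pose B (o : option (policy S A H)) : bool :=
    if o is Some pi then ~~ good s a pi else true.
  have EB M : trunc_exp K M n (fun _ o => (B o)%:R) = 1 - trunc_exp K M n
      (fun _ o => if o is Some pi then (good s a pi)%:R else 0).
    apply/eqP; rewrite eq_sym subr_eq -trunc_expD; apply/eqP.
    rewrite -[LHS](trunc_exp1 K M n); apply: eq_trunc_exp => w.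
    case=> [pi|] /=; rewrite ?addr0 //.
    by case: (good s a pi); rewrite /= ?mulr0n ?addr0 ?add0r.
  have := transport_chain K f0 (f1 s a) n B sz p01 q01 hD.
  rewrite !EB => /le_trans; apply; rewrite lerD2l.
  suff : 17 / 20 <= trunc_exp K (chain_mdp z (f1 s a)) n
      (fun _ o => if o is Some pi then (good s a pi)%:R else 0) by lra.
  apply: le_trans (hN (s, a) n (leq_bigmax _)) _; apply: le_trunc_exp => w.
  case=> // pi; case Eopt: (eps_optimal _ _ _); rewrite ?ler0n //.
  by rewrite (opt_good _ _ _ _ sz Eopt).
have sumG s : \sum_a G s a <= 1.
  rewrite -trunc_exp_sum -[leRHS](trunc_exp1 K M0 n).
  apply: le_trunc_exp => w [pi|].
    by apply: sum_exclusive_le1 => a b; exact: excl.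
  by rewrite big1 ?ler01.
have A2 : 2 <= #|A|%:R :> R by rewrite (ler_nat R 2).
have S2 : 2 <= #|S|%:R :> R by rewrite (ler_nat R 2).
(* Summing over actions leaves [(#|A| - 1) / 2 - 3 * #|A| / 20], which is at least [#|A| / 10] since
   [#|A| >= 2]. *)
have stepA s : s != z -> #|A|%:R / 10 <= D * \sum_a E s a.
  move=> sz; have : \sum_a (1 / 2 * (1 - G s a) - 3 / 20) <= \sum_a D * E s a.
    by apply: ler_sum => a _; rewrite lerBlDr step.
  rewrite -mulr_sumr sumrB -mulr_sumr sumrB !sumr_const.
  have := sumG s; rewrite -(mulr_natr (3 / 20)) -[#|_|]/#|A|; lra.
apply: (@le_trans _ _ (D * \sum_(s | s != z) \sum_a E s a)); last first.
  rewrite ler_wpM2l //; under eq_bigr do rewrite -trunc_exp_sum.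
  rewrite -trunc_exp_sum; apply: le_trunc_exp => w _.
  under eq_bigr do rewrite -natr_sum.
  by rewrite -natr_sum ler_nat sum_count_query.
rewrite mulr_sumr.
apply: (@le_trans _ _ (\sum_(s | s != z) #|A|%:R / 10)); last exact: ler_sum.
(* The states other than [z] are at least half of all, since [#|S| >= 2]. *)
rewrite sumr_const -(mulr_natr (_ / 10)).
have -> : #|[pred s | s != z]| = (#|S| - 1)%N.
  by rewrite (cardC1 z) subn1.
rewrite natrB ?(ltnW hS) //; nra.
Qed.

Lemma calls_ge_prob_ge0 (R : realType) (S A : finType) (H : nat)
    (K : algorithm R S A H) (M : mdp R S A) (n : nat) :
  0 <= calls_ge_prob K M n.
Proof. by apply: sumr_ge0 => w _; exact: run_prob_ge0. Qed.

Lemma expected_calls_ge (R : realType) (S A : finType) (H : nat)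
    (K : algorithm R S A H) (M : mdp R S A) (n : nat) (x : R) :
  x <= \sum_(k < n) calls_ge_prob K M k.+1 -> (x%:E <= expected_calls K M)%E.
Proof.
move=> x_le; apply: le_trans (nneseries_lim_ge n _); last first.
  by move=> k _ _; rewrite lee_fin calls_ge_prob_ge0.
rewrite sumEFin lee_fin (le_trans x_le) //.
by rewrite (big_mkord xpredT (fun k => calls_ge_prob K M k.+1)).
Qed.

(** The calls obey the rate even without the logarithm. Since [ln eps^-1 >= 1 / 2], dividing by it
    costs at most a factor 2, whence 40 in place of 20. *)
Lemma rate_le (R : realType) (eps h s a D C N : R) :
  0 < eps < 1 / 2 -> 0 <= h -> 0 <= s -> 0 <= a -> 0 < C -> 0 <= N ->
  D * h ^+ 3 <= C * eps ^+ 2 -> s * a / 20 <= D * N ->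
  (40 * C)^-1 * (h ^+ 3 * eps ^- 2 * s * a / ln eps^-1) <= N.
Proof.
move=> /andP[e0 e2] h0 s0 a0 C0 N0 DC saD.
have le_ln : 1 / 2 <= ln eps^-1.
  apply: le_trans (@ln2_ge_half R) _; rewrite ler_ln ?posrE ?invr_gt0 //.
  by rewrite -[leLHS]invrK lef_pV2 ?posrE ?invr_gt0 //; lra.
have l0 : 0 < ln eps^-1 by lra.
have e20 : 0 < eps ^+ 2 by rewrite exprn_gt0.
have h30 : 0 <= h ^+ 3 by rewrite exprn_ge0.
have main : h ^+ 3 * (s * a) <= 20 * C * eps ^+ 2 * N.
  have := ler_wpM2l h30 saD; have := ler_wpM2r N0 DC; lra.
rewrite ler_pdivrMl ?mulr_gt0 // ler_pdivrMr //.
have -> : h ^+ 3 * eps ^- 2 * s * a = h ^+ 3 * (s * a) / eps ^+ 2 by ring.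
rewrite ler_pdivrMr //; apply: le_trans main _.
have : 0 <= C * eps ^+ 2 * N by rewrite !mulr_ge0 // ltW.
nra.
Qed.

(** * Parameters for short and long horizons *)

Lemma bernoulli_inequality (R : realType) (x : R) (n : nat) :
  0 <= x <= 1 -> 1 - n%:R * x <= (1 - x) ^+ n.
Proof.
move=> /andP[x0 x1]; elim: n => [|n IH]; first by rewrite mul0r subr0 expr0.
rewrite exprS -natr1.
have : (1 - x) * (1 - n%:R * x) <= (1 - x) * (1 - x) ^+ n.
  by rewrite ler_wpM2l ?subr_ge0.
have : 0 <= n%:R * x * x by rewrite !mulr_ge0 ?ler0n.
lra.
Qed.

Lemma sum_remaining (H : nat) : (2 * \sum_(i < H) (H - i.+1) = H * H.-1)%N.
Proof.
elim: H => [|H IH]; first by rewrite big_ord0.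
rewrite big_ord_recl /= subSS subn0 mulnDr.
rewrite [X in (_ + 2 * X)%N](_ : _ = \sum_(i < H) (H - i.+1))%N ?IH.
  by nia.
by apply: eq_bigr => i _; rewrite subSS.
Qed.

Lemma late_stage_bound (R : realType) (S A : finType) (H : nat) (eps : R) :
  (1 < #|S|)%N -> (1 < #|A|)%N -> (1 < H)%N -> 0 < eps < 1 / 2 ->
  forall K : algorithm R S A H,
  (forall M, ((9 / 10)%:E <= success_prob K M eps)%E) ->
  exists M n, #|S|%:R * #|A|%:R / 20 <=
    50 * eps ^+ 2 * \sum_(k < n) calls_ge_prob K M k.+1.
Proof.
case: H => [|[|H]] // hS hA _ /andP[e0 e2] K hK.
have /card_gt0P[z _] : (0 < #|S|)%N by exact: ltnW.
have p01 : 0 <= (1 / 4 : R) <= 1 by lra.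
exists (uniform_chain S A z p01).
(* The horizon is now [H.+2], so index [H] is the last but one stage. It is the last at which the
   action matters, since rewards depend on the state only. *)
have ltHH : (H < H.+2)%N by [].
pose h := Ordinal ltHH.
(* A wrong action at [h] loses at least [q - p = 5 / 4 * eps], as the last stage is worth at least
   1. As [q < 7 / 8], the variance [q * (1 - q)] is at least 1/32, and [25 / 16 * 32 = 50]. *)
apply: (@chain_calls_lower R S A H.+2 K eps z
  (1 / 4) (1 / 4 + 5 / 4 * eps) _ p01
  (fun s a pi => pi (s, h) == a)) => //; try lra.
- rewrite ler_pdivrMr; last by rewrite mulr_gt0; lra.
  have : 1 / 32 <= (1 / 4 + 5 / 4 * eps) * (1 - (1 / 4 + 5 / 4 * eps)) by nra.
  have : 0 <= eps ^+ 2 by exact: sqr_ge0.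
  nra.
- by move=> s a b pi /eqP <- /eqP <-.
move=> s a f1 pi sz /(eps_optimal_gap h s); apply: contraTT => pi_a.
have pq : 0 <= (1 / 4 : R) <= 1 / 4 + 5 / 4 * eps by lra.
have gap0 := gap_ge0 f1 pi sz pq (ltn_ord h).
have gap := gap_step sz (proj2 (andP pq)) gap0.
have opt1 := opt_value_chain_ge f1 (Ordinal (ltnSn H.+1)) a sz.
rewrite -ltNge; apply: lt_le_trans gap; rewrite pi_a.
have := opt_value_ge0 H.+2 (chain_mdp z f1) H.+2 s.
rewrite /one_arm eqxx /= in gap0 opt1 *.
set y := opt_value _ _ H.+1 s in gap0 opt1 *.
set y' := opt_value _ _ _ _ in opt1 *.
nra.
Qed.

Lemma long_horizon_bound (R : realType) (S A : finType) (H : nat) (eps : R) :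
  (1 < #|S|)%N -> (1 < #|A|)%N -> (64 <= H)%N -> 0 < eps < 1 / 2 ->
  forall K : algorithm R S A H,
  (forall M, ((9 / 10)%:E <= success_prob K M eps)%E) ->
  exists M n, #|S|%:R * #|A|%:R / 20 <=
    8 * 32 ^+ 2 * eps ^+ 2 / H%:R ^+ 3 * \sum_(k < n) calls_ge_prob K M k.+1.
Proof.
move=> hS hA hH /andP[e0 e2] K hK.
have /card_gt0P[z _] : (0 < #|S|)%N by exact: ltnW.
have H64 : 64 <= H%:R :> R by rewrite (ler_nat R 64).
pose x : R := H%:R^-1.
have Hx : H%:R * x = 1 by rewrite divff //; lra.
have x0 : 0 < x by rewrite invr_gt0; lra.
have x64 : 64 * x <= 1 by nra.
have -> : 8 * 32 ^+ 2 * eps ^+ 2 / H%:R ^+ 3 = 8 * 32 ^+ 2 * eps ^+ 2 * x ^+ 3.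
  by rewrite -exprVn.
have x2 : 0 < x ^+ 2 by rewrite exprn_gt0.
(* The factor 32 makes the final gap at least [2 * eps]. With [eps < 1 / 2] and [H >= 64] it still
   keeps [delta <= x / 4], so the variance of [q] is at least [x / 8]. *)
pose delta := 32 * eps * x ^+ 2.
have delta0 : 0 < delta by rewrite !mulr_gt0.
have delta_le : delta <= x / 4 by rewrite /delta; nra.
have p01 : 0 <= 1 - x / 2 <= 1 by lra.
exists (uniform_chain S A z p01).
(* Stage [i] is weighted by the number of stages after it, as in [gap_lower]. An action is good if
   its stages carry more than half of the total weight, which two actions cannot both do. *)
apply: (@chain_calls_lower R S A H K eps z (1 - x / 2) (1 - x / 2 + delta) _ p01
  (fun s a pi => \sum_(i < H) (H - i.+1) <
     2 * \sum_(i < H | pi (s, i) == a) (H - i.+1))%N) => //; try lra.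
- rewrite ler_pdivrMr; last by rewrite mulr_gt0; lra.
  have : x / 8 <= (1 - x / 2 + delta) * (1 - (1 - x / 2 + delta)) by nra.
  have : 0 <= 8 * 32 ^+ 2 * eps ^+ 2 * x ^+ 3.
    by rewrite !mulr_ge0 ?exprn_ge0 ?(ltW e0) ?(ltW x0).
  move=> D0 /(ler_wpM2l D0); apply: le_trans; rewrite /delta.
  by rewrite le_eqVlt; apply/orP; left; apply/eqP; field.
- move=> s a b pi maj_a maj_b; apply/eqP/negPn/negP => ab.
  suff : (\sum_(i < H | pi (s, i) == a) (H - i.+1) +
    \sum_(i < H | pi (s, i) == b) (H - i.+1) <= \sum_(i < H) (H - i.+1))%N.
    by move: maj_a maj_b; clear; lia.
  rewrite [leqRHS](bigID (fun i => pi (s, i) == a)) /= leq_add2l.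
  rewrite [leqLHS]big_mkcond [leqRHS]big_mkcond /=; apply: leq_sum => i _.
  by case: eqP => // ->; rewrite eq_sym ab.
move=> s a f1 pi sz opt; rewrite ltnNge; apply/negP => minor.
have H0 : (0 < H)%N by exact: leq_trans hH.
have := eps_optimal_gap (Ordinal H0) s opt; apply/negP; rewrite -ltNge /=.
have pq : 0 <= 1 - x / 2 <= 1 - x / 2 + delta by lra.
apply: lt_le_trans (gap_lower f1 pi sz pq _ (leq0n H)); last by lra.
set W := (\sum_(i < H | _) _)%N.
have W_ge : (H * H.-1 <= 4 * W)%N.
  rewrite -sum_remaining; move: minor.
  rewrite (bigID (fun i => pi (s, i) == a) xpredT) /= -/W.
  by clear; lia.
have W_geR : H%:R ^+ 2 <= 8 * W%:R :> R.
  rewrite -natrX -natrM ler_nat; clearbody W; clear -W_ge hH; nia.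
(* With [x = 1 / H], the chain survives the whole horizon with probability at least
   [1 - H * (x / 2) = 1 / 2]. *)
have pH : 1 / 2 <= (1 - x / 2) ^+ (H - 0).
  have := @bernoulli_inequality R (x / 2) H; rewrite subn0; nra.
have -> : 1 - x / 2 + delta - (1 - x / 2) = delta by ring.
apply: (@lt_le_trans _ _ (delta * (1 / 2) * W%:R)); last first.
  by rewrite ler_wpM2r ?ler0n // ler_wpM2l // ltW.
have : 16 * eps * x ^+ 2 * H%:R ^+ 2 <= 16 * eps * x ^+ 2 * (8 * W%:R).
  by rewrite ler_wpM2l // !mulr_ge0 // ltW.
rewrite -[leLHS]mulrA -exprMn [x * _]mulrC Hx expr1n /delta; lra.
Qed.

Theorem corollaryF7 (R : realType) :
  exists c : R, 0 < c /\
    forall (S A : finType) (H : nat) (eps : R)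
      (hS : (1 < #|S|)%N) (hA : (1 < #|A|)%N) (hH : (1 < H)%N)
      (heps : 0 < eps < 1 / 2)
      (K : algorithm R S A H)
      (hK : forall M : mdp R S A, ((9 / 10)%:E <= success_prob K M eps)%E),
    exists M : mdp R S A,
      ((c * (H%:R ^+ 3 * eps ^- 2 * #|S|%:R * #|A|%:R / ln (eps^-1)))%:E
         <= expected_calls K M)%E.
Proof.
(* For [H < 64], [H ^ 3] is absorbed into [64 ^ 3]; this [C] also exceeds the constant [8 * 32 ^ 2]
   of the long horizons. *)
pose C : R := 50 * 64 ^+ 3.
have C0 : 0 < C by rewrite mulr_gt0 ?exprn_gt0.
exists (40 * C)^-1; split; first by rewrite invr_gt0 mulr_gt0.
move=> S A H eps hS hA hH heps K hK.
have [H64|H64] := leqP 64 H.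
  have [M [n hn]] := long_horizon_bound hS hA H64 heps hK.
  exists M; apply: (@expected_calls_ge _ _ _ _ _ _ n).
  apply: rate_le hn => //.
    by apply: sumr_ge0 => k _; exact: calls_ge_prob_ge0.
  rewrite divfK; last by rewrite expf_neq0 // pnatr_eq0; case: (H) hH.
  by rewrite ler_wpM2r ?sqr_ge0 // /C; lra.
have [M [n hn]] := late_stage_bound hS hA hH heps hK.
exists M; apply: (@expected_calls_ge _ _ _ _ _ _ n).
apply: rate_le hn => //.
  by apply: sumr_ge0 => k _; exact: calls_ge_prob_ge0.
rewrite /C mulrAC ler_wpM2r ?sqr_ge0 // ler_wpM2l //.
by rewrite lerXn2r ?nnegrE ?ler0n // (ler_nat R H 64) ltnW.
Qed.
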